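(* (i) Assume $\mu$-strong convexity, $L$-smoothness and $(\epsilon_i)$-sensitivity (spelled out in the context), and let $\overline\epsilon:=\sum_{i=1}^N p_i\epsilon_i$. If $\overline\epsilon<\mu/L$, then the map $\Phi(\boldsymbol\theta):=\arg\min_{\boldsymbol\theta'\in\mathbb R^m}f(\boldsymbol\theta';\boldsymbol\theta)$ is a contraction of $\mathbb R^m$, with a unique fixed point $\boldsymbol\theta^{PS}=\Phi(\boldsymbol\theta^{PS})$. (ii) If $\overline\epsilon\ge\mu/L$ (where $0<\mu\le L$, $\epsilon_i>0$ and weights $p_i>0$ with $\sum_i p_i=1$ are given), then there is an instance (loss $\ell$ and distribution maps $\mathcal D_i$) satisfying $\mu$-strong convexity, $L$-smoothness and $(\epsilon_i)$-sensitivity for which every sequence generated by $\boldsymbol\theta^{t+1}=\Phi(\boldsymbol\theta^t)$ diverges.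
   Context: Setting. $N,m,M\ge 1$; weights $p_1,\dots,p_N>0$ with $\sum_i p_i=1$; $\mathcal Z\subseteq\mathbb R^M$. For each client $i$ and each $\boldsymbol\theta\in\mathbb R^m$, $\mathcal D_i(\boldsymbol\theta)$ is a probability distribution on $\mathcal Z$. $\ell(\boldsymbol\theta;z)$ is a loss, $\nabla\ell$ its gradient in $\boldsymbol\theta$. $f_i(\boldsymbol\theta;\tilde{\boldsymbol\theta}):=\mathbb E_{Z\sim\mathcal D_i(\tilde{\boldsymbol\theta})}[\ell(\boldsymbol\theta;Z)]$, $f:=\sum_i p_i f_i$; $\nabla f_i,\nabla f$ are gradients in the first argument. Expectations are assumed finite and $\nabla f_i(\boldsymbol\theta;\tilde{\boldsymbol\theta})=\mathbb E_{Z\sim\mathcal D_i(\tilde{\boldsymbol\theta})}[\nabla\ell(\boldsymbol\theta;Z)]$. Assumptions (for all $\boldsymbol\theta,\boldsymbol\theta',\tilde{\boldsymbol\theta}\in\mathbb R^m$, $z,z'\in\mathcal Z$, $i$): - $\mu$-strong convexity ($\mu>0$): $f(\boldsymbol\theta';\tilde{\boldsymbol\theta})\ge f(\boldsymbol\theta;\tilde{\boldsymbol\theta})+\langle\nabla f(\boldsymbol\theta;\tilde{\boldsymbol\theta}),\boldsymbol\theta'-\boldsymbol\theta\rangle+\frac\mu2\|\boldsymbol\theta'-\boldsymbol\theta\|_2^2$. - $L$-smoothness: $\|\nabla\ell(\boldsymbol\theta;z)-\nabla\ell(\boldsymbol\theta';z')\|_2\le L(\|\boldsymbol\theta-\boldsymbol\theta'\|_2+\|z-z'\|_2)$.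 - $(\epsilon_i)$-sensitivity ($\epsilon_i>0$): $\mathcal W_1(\mathcal D_i(\boldsymbol\theta),\mathcal D_i(\boldsymbol\theta'))\le\epsilon_i\|\boldsymbol\theta-\boldsymbol\theta'\|_2$, with $\mathcal W_1$ the 1-Wasserstein distance for the Euclidean norm. *)

(* Defs.v *)
From HB Require Import structures.
From mathcomp Require Import all_boot all_order all_algebra.
From mathcomp Require Import all_classical all_reals all_analysis.

Set Implicit Arguments.
Unset Strict Implicit.
Unset Printing Implicit Defensive.
Import Order.TTheory GRing.Theory Num.Theory.
Import numFieldNormedType.Exports.
Local Open Scope classical_set_scope.
Local Open Scope ring_scope.

(* The library norm [`|_|] on matrices is the max norm, hence an explicit
   Euclidean inner product and norm. *)
Definition dotv (R : realType) (n : nat) (u v : 'rV[R]_n) : R :=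
  \sum_(i < n) u 0 i * v 0 i.

Definition norm2 (R : realType) (n : nat) (u : 'rV[R]_n) : R :=
  Num.sqrt (dotv u u).

(* Meaningful where [g] is differentiable, which is always required
   separately below. *)
Definition grad (R : realType) (n : nat) (g : 'rV[R]_n -> R) (x : 'rV[R]_n) :
    'rV[R]_n :=
  \row_(k < n) 'D_(delta_mx 0 k) g x.

Definition argmin (R : realType) (T : Type) (g : T -> R) : set T :=
  [set x | forall y, g x <= g y].

Definition contraction2 (R : realType) (n : nat) (g : 'rV[R]_n -> 'rV[R]_n) :=
  exists q : R, [/\ 0 <= q, q < 1 &
    forall x y, norm2 (g x - g y) <= q * norm2 (x - y)].

(* The subset [Z] of R^M as a type. Measurable types of the library are
   pointed, hence the argument [Z0]; a set carrying a probability distribution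
   is nonempty anyway. *)
Definition subset_space (R : realType) (M : nat) (Z : set 'rV[R]_M)
    (Z0 : Z !=set0) : Type := set_type Z.

Section subset_space_instances.
Variables (R : realType) (M : nat) (Z : set 'rV[R]_M) (Z0 : Z !=set0).

HB.instance Definition _ := Choice.on (subset_space Z0).
HB.instance Definition _ := isPointed.Build (subset_space Z0)
  (SigSub (mem_set (projT2 (cid Z0)))).

(* The open sets of the subspace topology on [Z]. *)
Definition subset_open : set (set (subset_space Z0)) := @open (set_type Z).

End subset_space_instances.

(* [Z] with its Borel sigma-algebra; [Z] itself need not be Borel in R^M. *)
Notation borel_subset Z0 := (g_sigma_algebraType (@subset_open _ _ _ Z0)).

Section performative_prediction.
Variables (R : realType) (N m M : nat) (Z : set 'rV[R]_M) (Z0 : Z !=set0).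

Definition coupling (P Q : probability (borel_subset Z0) R) :
    set (probability (borel_subset Z0 * borel_subset Z0)%type R) :=
  [set g | forall A : set (borel_subset Z0), measurable A ->
    g (A `*` setT) = P A /\ g (setT `*` A) = Q A].

(* With values in [\bar R]: it is [+oo] when every coupling has infinite
   cost. *)
Definition wasserstein1 (P Q : probability (borel_subset Z0) R) : \bar R :=
  ereal_inf [set (\int[g]_x (norm2 (sval x.1 - sval x.2))%:E)%E
            | g in coupling P Q].

Variables (p : 'I_N -> R) (l : 'rV[R]_m -> borel_subset Z0 -> R)
  (D : 'I_N -> 'rV[R]_m -> probability (borel_subset Z0) R).

Definition grad_loss (th : 'rV[R]_m) (z : borel_subset Z0) : 'rV[R]_m :=
  grad (l ^~ z) th.

Definition client_risk (i : 'I_N) (th tth : 'rV[R]_m) : R :=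
  fine ('E_(D i tth)[l th])%E.

Definition risk (th tth : 'rV[R]_m) : R :=
  \sum_(i < N) p i * client_risk i th tth.

Record regular_instance : Prop := RegularInstance {
  loss_differentiable : forall z th, differentiable (l ^~ z) th ;
  loss_integrable : forall i th tth,
    (D i tth).-integrable setT (EFin \o l th) ;
  grad_loss_integrable : forall i th tth (k : 'I_m),
    (D i tth).-integrable setT (EFin \o (fun z => grad_loss th z 0 k)) ;
  client_risk_differentiable : forall i th tth,
    differentiable (client_risk i ^~ tth) th ;
  grad_client_risk : forall i th tth,
    grad (client_risk i ^~ tth) th =
    \row_(k < m) fine ('E_(D i tth)[fun z => (grad_loss th z 0 k)%R])%E }.

Definition strongly_convex (mu : R) := forall th th' tth : 'rV[R]_m,
  risk th tth + dotv (grad (risk ^~ tth) th) (th' - th)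
    + mu / 2 * norm2 (th' - th) ^+ 2 <= risk th' tth.

Definition smooth (L : R) := forall (th th' : 'rV[R]_m) (z z' : borel_subset Z0),
  norm2 (grad_loss th z - grad_loss th' z')
    <= L * (norm2 (th - th') + norm2 (sval z - sval z')).

Definition sensitive (eps : 'I_N -> R) := forall i (th th' : 'rV[R]_m),
  (wasserstein1 (D i th) (D i th') <= (eps i * norm2 (th - th'))%:E)%E.

(* [Phi] is the map [th |-> argmin_th' risk th' th], the minimizer being
   unique. *)
Definition is_argmin_map (Phi : 'rV[R]_m -> 'rV[R]_m) := forall th,
  argmin (risk ^~ th) = [set Phi th].

End performative_prediction.

(* Main.v *)
From HB Require Import structures.
Require Import Defs.
From mathcomp Require Import all_boot all_order all_algebra.
From mathcomp Require Import all_classical all_reals all_analysis.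
From mathcomp Require Import measurable_realfun ring lra.
Import Order.TTheory GRing.Theory Num.Theory.
Import numFieldNormedType.Exports.
Local Open Scope classical_set_scope.
Local Open Scope ring_scope.

(* (i) The gradient of the risk is Lipschitz and strongly monotone in its first
   argument, so a short gradient step is a contraction; its fixed point is the
   minimizer. Integrating the smoothness bound against a coupling shows that
   the gradient is [L * eps i]-Lipschitz in the deployed parameter, and strong
   monotonicity turns this into the ratio [L * epsbar / mu] for [Phi].
   (ii) Affine maps [Phi] of ratio [L * epsbar / mu > 1] still have a fixed
   point, from which the iteration converges. Hence the distributions react
   with the smaller sensitivities [eps i * mu / (L * epsbar)], which make [Phi]
   a translation on the line spanned by the first basis vector: the point mass
   of client [i] sits at this multiple of the first coordinate, plus 1. *)

(** * Euclidean inner product and norm, and fixed points of contractions *)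

Section euclidean_norm.
Context {R : realType} {n : nat}.
Implicit Types (u v w : 'rV[R]_n) (a : R).

Lemma dotvC u v : dotv u v = dotv v u.
Proof. by apply: eq_bigr => i _; rewrite mulrC. Qed.

Lemma dotvDl u v w : dotv (u + v) w = dotv u w + dotv v w.
Proof. by rewrite -big_split; apply: eq_bigr => i _; rewrite mxE mulrDl. Qed.

Lemma dotvZl a u w : dotv (a *: u) w = a * dotv u w.
Proof.
by rewrite /dotv mulr_sumr; apply: eq_bigr => i _; rewrite mxE mulrA.
Qed.

Lemma dotvBl u v w : dotv (u - v) w = dotv u w - dotv v w.
Proof. by rewrite -scaleN1r dotvDl dotvZl mulN1r. Qed.

Lemma dotvDr u v w : dotv u (v + w) = dotv u v + dotv u w.
Proof. by rewrite dotvC dotvDl !(dotvC u). Qed.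

Lemma dotvZr a u w : dotv u (a *: w) = a * dotv u w.
Proof. by rewrite dotvC dotvZl dotvC. Qed.

Lemma dotvBr u v w : dotv u (v - w) = dotv u v - dotv u w.
Proof. by rewrite dotvC dotvBl !(dotvC u). Qed.

Lemma dot0v u : dotv 0 u = 0.
Proof. by rewrite -(scale0r 0) dotvZl mul0r. Qed.

Lemma dotvv_ge0 u : 0 <= dotv u u.
Proof. by apply: sumr_ge0 => i _; rewrite -expr2 sqr_ge0. Qed.

Lemma sqr_norm2 u : norm2 u ^+ 2 = dotv u u.
Proof. by rewrite sqr_sqrtr// dotvv_ge0. Qed.

Lemma norm2_ge0 u : 0 <= norm2 u.
Proof. exact: sqrtr_ge0. Qed.

Lemma norm2_eq0 u : (norm2 u == 0) = (u == 0).
Proof.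
apply/idP/eqP => [u0|->]; last first.
  by rewrite /norm2 /dotv big1 ?sqrtr0// => i _; rewrite mxE mul0r.
have : dotv u u = 0 by rewrite -sqr_norm2 (eqP u0) expr0n.
move/eqP; rewrite psumr_eq0 => [/allP h|i _]; last by rewrite -expr2 sqr_ge0.
apply/rowP => i; rewrite mxE.
by apply/eqP; have := h i (mem_index_enum i); rewrite /= -expr2 sqrf_eq0.
Qed.

Lemma norm20 : norm2 (0 : 'rV[R]_n) = 0.
Proof. by apply/eqP; rewrite norm2_eq0. Qed.

Lemma norm2Z a u : norm2 (a *: u) = `|a| * norm2 u.
Proof.
by rewrite /norm2 dotvZl dotvZr mulrA -expr2 sqrtrM ?sqr_ge0// sqrtr_sqr.
Qed.

Lemma norm2B u v : norm2 (u - v) = norm2 (v - u).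
Proof. by rewrite -opprB -scaleN1r norm2Z normrN1 mul1r. Qed.

Lemma dotv_le u v : dotv u v <= norm2 u * norm2 v.
Proof.
have [v0|vN0] := eqVneq (norm2 v) 0.
  move/eqP: (v0); rewrite norm2_eq0 => /eqP ->.
  by rewrite dotvC dot0v norm20 mulr0.
have v_gt0 : 0 < norm2 v by rewrite lt_neqAle eq_sym vN0 norm2_ge0.
apply: le_trans (ler_norm _) _.
rewrite -[leRHS]ger0_norm ?mulr_ge0 ?norm2_ge0//.
rewrite -ler_sqr ?nnegrE// !real_normK ?num_real// exprMn.
(* Cauchy-Schwarz: this vector is |v|^2 times the part of [u] orthogonal to [v], and its squared
   norm is |v|^2 (|u|^2 |v|^2 - <u,v>^2). *)
have := dotvv_ge0 (norm2 v ^+ 2 *: u - dotv u v *: v).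
rewrite !(dotvBl, dotvBr, dotvZl, dotvZr) -!sqr_norm2 (dotvC v u) => h.
have v2 : 0 < norm2 v ^+ 2 by rewrite exprn_gt0.
rewrite -subr_ge0 -(pmulr_rge0 _ v2); apply: le_trans h _.
by rewrite le_eqVlt; apply/orP; left; apply/eqP; ring.
Qed.

Lemma norm2_triangle u v : norm2 (u + v) <= norm2 u + norm2 v.
Proof.
rewrite -ler_sqr ?nnegrE ?addr_ge0 ?norm2_ge0//.
rewrite sqr_norm2 dotvDl !dotvDr -!sqr_norm2 (dotvC v u).
have := dotv_le u v; nra.
Qed.

Lemma norm2_sum (I : Type) (r : seq I) (F : I -> 'rV[R]_n) :
  norm2 (\sum_(i <- r) F i) <= \sum_(i <- r) norm2 (F i).
Proof.
elim/big_rec2 : _ => [|i x y _ h]; first by rewrite norm20.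
by apply: le_trans (norm2_triangle _ _) _; rewrite lerD2l.
Qed.

Lemma coord_le_norm2 u (j : 'I_n) : `|u 0 j| <= norm2 u.
Proof.
rewrite -ler_sqr ?nnegrE ?norm2_ge0// real_normK ?num_real// sqr_norm2.
rewrite /dotv (bigD1 j)//= -expr2 lerDl.
by apply: sumr_ge0 => k _; rewrite -expr2 sqr_ge0.
Qed.

Lemma mx_norm_le_norm2 u : `|u| <= norm2 u.
Proof.
rewrite [leLHS]mx_normrE; apply: bigmax_le => [|[i j] _ /=].
  exact: norm2_ge0.
by rewrite (ord1 i) coord_le_norm2.
Qed.

Lemma norm2_delta (i : 'I_n) : norm2 (delta_mx 0 i : 'rV[R]_n) = 1.
Proof.
rewrite /norm2 /dotv (bigD1 i)//= !mxE !eqxx mulr1 big1 ?addr0 ?sqrtr1//.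
by move=> j ji; rewrite !mxE (negbTE ji) mulr0.
Qed.

(** The triangle inequality over the basis expansion gives the crude factor [n], which is enough to
    pass contractions from one norm to the other. *)
Lemma norm2_le_mx_norm u : norm2 u <= n%:R * `|u|.
Proof.
rewrite [X in norm2 X](row_sum_delta u).
apply: le_trans (norm2_sum _ _ _) _.
apply: (@le_trans _ _ (\sum_(i < n) `|u|)); last first.
  by rewrite sumr_const card_ord mulr_natl.
apply: ler_sum => i _; rewrite norm2Z.
rewrite norm2_delta mulr1 [leRHS]mx_normrE.
exact: (@le_bigmax _ _ _ 0 (fun ij => `|u ij.1 ij.2|)
  (0, i)).
Qed.

(* The library's fixed-point theorem speaks of the max norm: some iterate of
   [g] is a contraction for it, and the unique fixed point of that iterate is
   fixed by [g]. *)
Lemma norm2_fixed_point (g : 'rV[R]_n -> 'rV[R]_n) :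
  contraction2 g -> exists x, x = g x.
Proof.
move=> [q [q0 q1 gq]].
have gk k x y : norm2 (iter k g x - iter k g y) <= q ^+ k * norm2 (x - y).
  elim: k => [|k ih]; first by rewrite expr0 mul1r.
  by rewrite !iterS exprS -mulrA; apply: le_trans (gq _ _) _; rewrite ler_wpM2l.
(* [q ^+ k] has to absorb the factor [n] of the norm comparison; [n.+1] keeps the inverse positive
   when [n = 0]. *)
have [k kq] : exists k, q ^+ k * n.+1%:R < 1.
  have /cvgrPdist_lt /(_ (n.+1%:R^-1)) : q ^+ k @[k --> \oo] --> (0:R).
    by apply: cvg_expr; rewrite ger0_norm.
  rewrite invr_gt0 ltr0Sn => /(_ isT) [k _ /(_ k (leqnn _))].
  rewrite sub0r normrN ger0_norm ?exprn_ge0// => qk; exists k.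
  by rewrite -ltr_pdivlMr// mul1r.
have qk0 : 0 <= q ^+ k by rewrite exprn_ge0.
have nn1 : n%:R <= n.+1%:R :> R by rewrite ler_nat.
have n1 : 1 <= n.+1%:R :> R by rewrite ler1n.
have kq0 : 0 <= q ^+ k * n%:R by rewrite mulr_ge0.
have fg : set_fun setT setT (iter k g) by [].
pose f : {fun [set: 'rV[R]_n] >-> [set: 'rV[R]_n]} := mkfun fg.
pose X : completeNormedModType R := HB.pack 'rV[R]_n.
have [|||x _ xf] := @banach_fixed_point R X setT f.
- exists (NngNum kq0); split => [|[x y] _] /=.
    by apply: le_lt_trans kq; rewrite ler_wpM2l.
  apply: le_trans (mx_norm_le_norm2 _) _; apply: le_trans (gk _ _ _) _.
  by rewrite -mulrA ler_wpM2l ?exprn_ge0// norm2_le_mx_norm.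
- exact: closedT.
- by exists (0 : 'rV[R]_n).
have {}xf : x = iter k g x by [].
(* The [k]-th iterate fixes both [x] and [g x], so their distance is at most [q ^+ k < 1] times
   itself. *)
exists x; apply/eqP; rewrite -subr_eq0 -norm2_eq0.
have := gk k x (g x); rewrite -iterSr iterS -xf.
have := norm2_ge0 (x - g x).
by move=> *; apply/eqP; nra.
Qed.
Lemma norm2_fixed_point_unique (g : 'rV[R]_n -> 'rV[R]_n) :
  contraction2 g -> exists! x, x = g x.
Proof.
move=> gc; have [x xg] := norm2_fixed_point g gc.
exists x; split => // y yg; have [q [_ q1 /(_ x y)]] := gc.
rewrite -xg -yg => xy; apply/eqP; rewrite -subr_eq0 -norm2_eq0.
by have := norm2_ge0 (x - y) => xy0; apply/eqP; nra.
Qed.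

End euclidean_norm.

(** * Integrals of vector-valued functions and change of variables *)

Section integral.
Context {R : realType} {d : measure_display} {T : measurableType d}.

Lemma integrable_dotv {n : nat} (P : {measure set T -> \bar R})
    (G : T -> 'rV[R]_n) (v : 'rV[R]_n) :
  (forall k, P.-integrable setT (fun t => (G t 0 k)%:E)) ->
  P.-integrable setT (fun t => (dotv v (G t))%:E).
Proof.
move=> iG.
have -> : (fun t => (dotv v (G t))%:E) =
    (fun t => \sum_(k < n) (v 0 k)%:E * (G t 0 k)%:E)%E.
  by apply/funext => t; rewrite /dotv -sumEFin; under eq_bigr do rewrite EFinM.
by apply: integrable_sum => // k _; apply: integrableZl.
Qed.

Lemma dotv_integral {n : nat} (P : {measure set T -> \bar R})
    (G : T -> 'rV[R]_n) (v : 'rV[R]_n) :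
  (forall k, P.-integrable setT (fun t => (G t 0 k)%:E)) ->
  (dotv v (\row_k fine (\int[P]_t (G t 0 k)%:E)%E))%:E =
  (\int[P]_t (dotv v (G t))%:E)%E.
Proof.
move=> iG; rewrite /dotv -sumEFin.
under [RHS]eq_integral do rewrite -sumEFin.
rewrite integral_sum//; last first.
  by move=> k; under eq_fun do rewrite EFinM; apply: integrableZl.
apply: eq_bigr => k _; rewrite mxE EFinM fineK; last exact: integrable_fin_num.
by rewrite -integralZl//; apply: eq_integral => t _; rewrite EFinM.
Qed.

(* Testing the integral against itself reduces Jensen's inequality for the
   Euclidean norm to Cauchy-Schwarz under the integral sign. *)
Lemma norm2_integral_le {n : nat} (P : {measure set T -> \bar R})
    (G : T -> 'rV[R]_n) (h : T -> R) :
  (forall k, P.-integrable setT (fun t => (G t 0 k)%:E)) ->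
  measurable_fun setT h -> (forall t, norm2 (G t) <= h t) ->
  ((norm2 (\row_k fine (\int[P]_t (G t 0 k)%:E)%E))%:E <= \int[P]_t (h t)%:E)%E.
Proof.
move=> iG mh Gh; set v := (X in norm2 X).
have h0 t : 0 <= h t := le_trans (norm2_ge0 _) (Gh t).
have /measurable_EFinP mh' := mh.
have [v0|vN0] := eqVneq (norm2 v) 0.
  by rewrite v0; apply: integral_ge0 => t _; rewrite lee_fin.
have v_gt0 : 0 < norm2 v by rewrite lt_neqAle eq_sym vN0 norm2_ge0.
rewrite -(@lee_pmul2l _ (norm2 v)%:E)// ?lte_fin// -EFinM -expr2 sqr_norm2.
rewrite dotv_integral// -ge0_integralZl_EFin ?norm2_ge0//; last first.
  by move=> t _; rewrite lee_fin.
have iv := integrable_dotv P G v iG.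
(* The integral of [h] may be infinite; absolute values allow monotonicity of the integral for
   nonnegative functions. *)
apply: le_trans (_ : (\int[P]_t `|(dotv v (G t))%:E| <= _)%E); last first.
  apply: ge0_le_integral => //.
  - by apply: measurableT_comp => //; apply: measurable_int iv.
  - by apply: emeasurable_funM.
  - move=> t _; rewrite -EFinM abse_EFin lee_fin.
    apply: (@le_trans _ _ (norm2 v * norm2 (G t))); last first.
      by rewrite ler_wpM2l ?norm2_ge0.
    rewrite ler_norml dotv_le andbT lerNl.
    have := dotv_le (- v) (G t).
    by rewrite -scaleN1r dotvZl norm2Z normrN1 mulN1r mul1r.
have := le_abse_integral P measurableT (measurable_int _ iv).
exact/le_trans/lee_abs.
Qed.

(** Change of variables, to be applied to the two projections of a coupling. *)
Lemma integral_pushforward_eq {d' : measure_display} {U : measurableType d'}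
    (g : {measure set T -> \bar R}) (P : {measure set U -> \bar R})
    (phi : T -> U) (f : U -> R) :
  measurable_fun setT phi ->
  (forall A, measurable A -> g (phi @^-1` A) = P A) ->
  P.-integrable setT (fun u => (f u)%:E) ->
  g.-integrable setT (fun t => (f (phi t))%:E) /\
  (\int[g]_t (f (phi t))%:E = \int[P]_u (f u)%:E)%E.
Proof.
move=> mphi gP /integrableP[mf foo].
have mfphi : measurable_fun [set: T] (fun t => (f (phi t))%:E).
  exact: (measurableT_comp mf).
have pP (k : U -> \bar R) :
    (\int[pushforward g phi]_u k u = \int[P]_u k u)%E.
  by apply: eq_measure_integral => A mA _; exact: gP.
have ig : g.-integrable setT (fun t => (f (phi t))%:E).
  apply/integrableP; split => //.
  move: foo; rewrite -pP ge0_integral_pushforward//; exact: measurableT_comp.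
by split => //; rewrite -pP integral_pushforward.
Qed.

End integral.

(** * Measurability on [Z] and integration against a coupling *)

Section borel_subset.
Context {R : realType} {M : nat} {Z : set 'rV[R]_M} {Z0 : Z !=set0}.
Notation T := (borel_subset Z0).

(** Coordinates are continuous for the subspace topology, so preimages of open intervals are among
    the generators of the sigma-algebra. *)
Lemma measurable_coord (k : 'I_M) :
  measurable_fun [set: T] (fun z : T => sval z 0 k).
Proof.
apply: (measurability _ (RGenOpens.measurableE R)).
move=> _ [_ [a [b ->] <-]]; rewrite setTI; apply: sub_sigma_algebra.
rewrite /subset_open.
pose s := sval : set_type Z -> 'rV[R]_M.
have c1 : continuous s by apply: initial_continuous.
have c2 : continuous ((fun v : 'rV[R]_M => v 0 k) \o s).
  by move=> z; apply: continuous_comp; [exact: c1|exact: coord_continuous].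
move/continuousP : c2; apply; exact: interval_open.
Qed.

Lemma measurable_norm2_sub :
  measurable_fun [set: T * T] (fun z : T * T => norm2 (sval z.1 - sval z.2)).
Proof.
apply: (measurableT_comp (f := @Num.sqrt R)).
  by apply: continuous_measurable_fun; exact: sqrt_continuous.
apply: measurable_sum => k; under eq_fun do rewrite !mxE.
have m : measurable_fun [set: T * T]
    (fun z : T * T => sval z.1 0 k - sval z.2 0 k).
  by apply: measurable_funB; apply: (measurableT_comp (measurable_coord k)).
exact: measurable_funM.
Qed.

(** The marginals of [g] are its images under the projections. Two expectations thus become one
    integral, in which values of [f] can be compared pointwise. *)
Lemma coupling_integral (P Q : probability T R) (g : probability (T * T)%type R)
    (f : T -> R) :
  coupling P Q g ->
  P.-integrable setT (fun z => (f z)%:E) ->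
  Q.-integrable setT (fun z => (f z)%:E) ->
  g.-integrable setT (fun z => (f z.1 - f z.2)%:E) /\
  (\int[g]_z (f z.1 - f z.2)%:E =
   \int[P]_z (f z)%:E - \int[Q]_z (f z)%:E)%E.
Proof.
move=> gPQ iP iQ.
have [|i1 e1] := integral_pushforward_eq g P fst f measurable_fst _ iP.
  move=> A /gPQ [gA _]; rewrite -[RHS]gA; congr (g _).
  by apply/seteqP; split => [z|z []].
have [|i2 e2] := integral_pushforward_eq g Q snd f measurable_snd _ iQ.
  move=> A /gPQ [_ gA]; rewrite -[RHS]gA; congr (g _).
  by apply/seteqP; split => [z|z []].
split; first by under eq_fun do rewrite EFinB; exact: integrableB.
by rewrite -e1 -e2 -integralB_EFin//; apply: eq_integral => z _; rewrite EFinB.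
Qed.

End borel_subset.

(** * Gradient estimates, existence of minimizers and the contraction ratio *)

Section contraction.
Context {R : realType} {N m M : nat} {Z : set 'rV[R]_M} {Z0 : Z !=set0}.
Variables (p eps : 'I_N -> R) (mu L : R) (l : 'rV[R]_m -> borel_subset Z0 -> R)
  (D : 'I_N -> 'rV[R]_m -> probability (borel_subset Z0) R).
Hypotheses (p_gt0 : forall i, 0 < p i) (p_sum1 : \sum_(i < N) p i = 1)
  (mu_gt0 : 0 < mu) (L_gt0 : 0 < L)
  (lD_reg : regular_instance l D).
Local Notation F i t x := (grad (client_risk l D i ^~ t) x).
Local Notation G t x := (grad (risk p l D ^~ t) x).

Lemma grad_risk t x : G t x = \sum_(i < N) p i *: F i t x.
Proof.
apply/rowP => k; rewrite summxE !mxE.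
have -> : risk p l D ^~ t = \sum_(i < N) (p i \*: (client_risk l D i ^~ t)).
  by apply/funext => y; rewrite fct_sumE.
have d i : derivable (client_risk l D i ^~ t) x (delta_mx 0 k).
  by apply: diff_derivable; exact: client_risk_differentiable.
rewrite derive_sum => [|i]; last exact: derivableZ.
by apply: eq_bigr => i _; rewrite !mxE deriveZ.
Qed.

(** Serves both variations of the gradient: in its first argument and in the deployed parameter. *)
Lemma norm2_gradB_le (c : 'I_N -> R) t t' x x' :
  (forall i, norm2 (F i t x - F i t' x') <= c i) ->
  norm2 (G t x - G t' x') <= \sum_(i < N) p i * c i.
Proof.
move=> h; rewrite !grad_risk -sumrB; apply: le_trans (norm2_sum _ _ _) _.
by apply: ler_sum => i _; rewrite -scalerBr norm2Z gtr0_norm// ler_wpM2l// ltW.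
Qed.

Lemma grad_client_riskB i t t' x x' :
  F i t x - F i t' x' =
  \row_k (fine (\int[D i t]_z (grad_loss l x z 0 k)%:E)%E -
    fine (\int[D i t']_z (grad_loss l x' z 0 k)%:E)%E).
Proof.
by rewrite !grad_client_risk//; apply/rowP => k; rewrite !mxE !unlock.
Qed.

Hypothesis l_smooth : smooth l L.

(** Smoothness at a common point [z], integrated against a measure of mass one. *)
Lemma client_grad_lipschitz i t x x' :
  norm2 (F i t x - F i t x') <= L * norm2 (x - x').
Proof.
have ig y k : (D i t).-integrable setT (fun z => (grad_loss l y z 0 k)%:E).
  exact: grad_loss_integrable.
pose g z := grad_loss l x z - grad_loss l x' z.
have gE k z : g z 0 k = grad_loss l x z 0 k - grad_loss l x' z 0 k.
  by rewrite !mxE.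
have -> : F i t x - F i t x' = \row_k fine (\int[D i t]_z (g z 0 k)%:E)%E.
  rewrite grad_client_riskB; apply/rowP => k; rewrite !mxE.
  under [in RHS]eq_integral do rewrite gE EFinB.
  rewrite (integralB_EFin measurableT (ig x k) (ig x' k)) [RHS]fineB//.
  - exact: integrable_fin_num.
  - exact: integrable_fin_num.
rewrite -lee_fin; pose c := L * norm2 (x - x').
apply: le_trans (norm2_integral_le _ _ (cst c) _ _ _) _.
- by move=> k; under eq_fun do rewrite gE EFinB; exact: integrableB.
- exact: measurable_cst.
- by move=> z; apply: le_trans (l_smooth _ _ _ _) _; rewrite subrr norm20 addr0.
- by rewrite [leLHS](integral_cst (D i t) measurableT c%:E)
    [X in (_ * X)%E](probability_setT (D i t)) mule1.
Qed.

Lemma client_grad_sensitive i t t' x : sensitive D eps ->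
  norm2 (F i t x - F i t' x) <= L * eps i * norm2 (t - t').
Proof.
(* After division by [L], the left side has to be a lower bound of the Wasserstein infimum, that is,
   of the cost of every coupling [g]. *)
move=> Deps; rewrite -mulrA mulrC -ler_pdivrMr// -lee_fin.
apply: le_trans (Deps i t t'); apply/ereal_infP => _ [g gP <-].
rewrite mulrC EFinM lee_pdivrMl//.
have ig s k : (D i s).-integrable setT (fun z => (grad_loss l x z 0 k)%:E).
  exact: grad_loss_integrable.
pose h z := grad_loss l x z.1 - grad_loss l x z.2.
have hE k z : h z 0 k = grad_loss l x z.1 0 k - grad_loss l x z.2 0 k.
  by rewrite !mxE.
have -> : F i t x - F i t' x = \row_k fine (\int[g]_z (h z 0 k)%:E)%E.
  rewrite grad_client_riskB; apply/rowP => k; rewrite !mxE.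
  under [in RHS]eq_integral do rewrite hE.
  have [_ ->] := coupling_integral _ _ _ _ gP (ig t k) (ig t' k).
  rewrite [RHS]fineB; first by [].
  - exact: (integrable_fin_num _ (ig t k)).
  - exact: (integrable_fin_num _ (ig t' k)).
have mn := @measurable_norm2_sub R M Z Z0.
rewrite -ge0_integralZl_EFin//; last 3 first.
- by move=> z _; rewrite lee_fin norm2_ge0.
- exact/measurable_EFinP.
- exact: ltW.
under [leRHS]eq_integral do rewrite -EFinM.
apply: norm2_integral_le.
- move=> k; under eq_fun do rewrite hE.
  by have [] := coupling_integral _ _ _ _ gP (ig t k) (ig t' k).
- by apply: measurable_funM => //.
- by move=> z; apply: le_trans (l_smooth _ _ _ _) _; rewrite subrr norm20 add0r.
Qed.

Hypothesis f_convex : strongly_convex p l D mu.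

(** Adding strong convexity from [x] to [x'] and from [x'] to [x] cancels the values of the risk. *)
Lemma strongly_monotone t x x' :
  mu * norm2 (x - x') ^+ 2 <= dotv (G t x - G t x') (x - x').
Proof.
have h1 := f_convex x x' t; have h2 := f_convex x' x t.
move: h1 h2; rewrite (norm2B x') -(opprB x x').
rewrite -scaleN1r dotvZr mulN1r dotvBl; lra.
Qed.

(** At a critical point strong convexity becomes quadratic growth, which also excludes a second
    minimizer. *)
Lemma critical_argmin t x : G t x = 0 -> argmin (risk p l D ^~ t) = [set x].
Proof.
move=> Gx0.
have low y :
    risk p l D x t + mu / 2 * norm2 (y - x) ^+ 2 <= risk p l D y t.
  by have := f_convex x y t; rewrite Gx0 dot0v addr0.
have c0 : 0 < mu / 2 by rewrite divr_gt0.
apply/seteqP; split => [y|_ /= ->]; rewrite /argmin /=.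
  move=> /(_ x) yx.
  apply/eqP; rewrite -subr_eq0 -norm2_eq0 -sqrf_eq0 eq_le sqr_ge0 andbT.
  rewrite -(pmulr_rle0 _ c0); have := low y; lra.
by move=> y; apply: le_trans (low y); rewrite lerDl mulr_ge0 ?sqr_ge0// ltW.
Qed.

(* A gradient step of size [mu / L ^+ 2] is a contraction. *)
Lemma critical_point t : exists x, G t x = 0.
Proof.
have GL x y : norm2 (G t x - G t y) <= L * norm2 (x - y).
  apply: le_trans (norm2_gradB_le (fun=> L * norm2 (x - y)) _ _ _ _ _) _.
    by move=> i; exact: client_grad_lipschitz.
  by rewrite -mulr_suml p_sum1 mul1r.
pose s := mu / L ^+ 2.
have s_gt0 : 0 < s by rewrite divr_gt0 ?exprn_gt0.
have [|x] := norm2_fixed_point (fun x => x - s *: G t x).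
  (* Expanding the square gives the factor 1 - 2 s mu + s^2 L^2, which equals 1 - s mu for this [s].
     The maximum covers [mu > L], where 1 - s mu is negative. *)
  pose q := Num.sqrt (Num.max 0 (1 - s * mu)).
  have q2 : q ^+ 2 = Num.max 0 (1 - s * mu) by rewrite sqr_sqrtr// le_max lexx.
  exists q; split; first exact: sqrtr_ge0.
    rewrite -ltr_sqr ?nnegrE ?sqrtr_ge0// q2 expr1n gt_max ltr01/=.
    by rewrite ltrBlDr ltrDl mulr_gt0.
  move=> x y.
  rewrite -ler_sqr ?nnegrE ?mulr_ge0 ?norm2_ge0 ?sqrtr_ge0// exprMn q2.
  apply: (@le_trans _ _ ((1 - s * mu) * norm2 (x - y) ^+ 2)); last first.
    by rewrite ler_wpM2r ?sqr_ge0// le_max lexx orbT.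
  have -> : x - s *: G t x - (y - s *: G t y) = (x - y) - s *: (G t x - G t y).
    by rewrite scalerBr; apply/rowP => k; rewrite !mxE; ring.
  have h1 := strongly_monotone t x y.
  have h2 : norm2 (G t x - G t y) ^+ 2 <= L ^+ 2 * norm2 (x - y) ^+ 2.
    by rewrite -exprMn ler_sqr ?nnegrE ?mulr_ge0 ?norm2_ge0 ?(ltW L_gt0).
  have sL : s * L ^+ 2 = mu by rewrite divfK// gt_eqF ?exprn_gt0.
  move: h1 h2; move: (x - y) (G t x - G t y) => u v h1 h2.
  rewrite (sqr_norm2 (_ - _)) dotvBl !dotvBr !dotvZl !dotvZr.
  rewrite -!sqr_norm2 (dotvC u v).
  have : s * (s * norm2 v ^+ 2) <= s * (mu * norm2 u ^+ 2).
    by rewrite ler_pM2l// -sL -mulrA ler_pM2l.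
  have : s * (mu * norm2 u ^+ 2) <= s * dotv v u by rewrite ler_pM2l.
  lra.
move/eqP; rewrite -subr_eq0 opprB addrC subrK scaler_eq0 (gt_eqF s_gt0)/=.
move=> /eqP Gx0.
by exists x.
Qed.

(** Strong monotonicity between [Phi t] and [Phi t'] bounds mu |Phi t - Phi t'| by the norm of
    [G t (Phi t')]. As [G t' (Phi t')] vanishes, this norm measures only the change of deployed
    parameter, which sensitivity controls. *)
Lemma argmin_contraction (Phi : 'rV[R]_m -> 'rV[R]_m) :
  sensitive D eps ->
  (forall t, G t (Phi t) = 0) -> forall t t',
  norm2 (Phi t - Phi t') <=
    L * (\sum_(i < N) p i * eps i) / mu * norm2 (t - t').
Proof.
move=> Deps GPhi t t'.
set S := \sum_(i < N) p i * eps i.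
rewrite mulrAC ler_pdivlMr// mulrC.
have sens : norm2 (G t (Phi t') - G t' (Phi t')) <= L * S * norm2 (t - t').
  pose c i := L * eps i * norm2 (t - t').
  apply: le_trans (norm2_gradB_le c _ _ _ _ _) _.
    by move=> i; exact: client_grad_sensitive.
  rewrite le_eqVlt; apply/orP; left; apply/eqP.
  by rewrite /S mulr_sumr mulr_suml; apply: eq_bigr => i _; rewrite /c; ring.
apply: le_trans sens; rewrite GPhi subr0.
have := strongly_monotone t (Phi t') (Phi t).
rewrite GPhi subr0 (norm2B (Phi t')).
have := dotv_le (G t (Phi t')) (Phi t' - Phi t).
rewrite (norm2B (Phi t')) => h1 h2.
have := le_trans h2 h1; have := norm2_ge0 (G t (Phi t')).
set u := norm2 (Phi t - Phi t'); set v := norm2 (G t _) => v0 h.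
(* A factor [u] is cancelled below, so [u = 0] is treated apart. *)
have [->|uN0] := eqVneq u 0; first by rewrite mulr0.
have u0 : 0 < u by rewrite lt_neqAle eq_sym uN0 norm2_ge0.
by rewrite -(ler_pM2r u0) -mulrA -expr2.
Qed.
End contraction.

(** * Quadratic functions and their gradients *)

Section quadratic.
Context {R : realType} {n : nat}.
Implicit Types (c : R) (w x v : 'rV[R]_n).

(** For nonzero [c] this is, up to an additive constant, c / 2 times the squared distance to w /
    c. *)
Definition quadratic c w x := c / 2 * dotv x x - dotv w x.

Lemma derive_coord x v (k : 'I_n) : 'D_v (fun y : 'rV[R]_n => y 0 k) x = v 0 k.
Proof.
have di : derivable (@id 'rV[R]_n) x v by [].
have := derive_mx di.
by rewrite derive_id => /matrixP /(_ 0 k); rewrite mxE => ->.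
Qed.

Lemma is_derive_coord x v (k : 'I_n) :
  is_derive x v (fun y : 'rV[R]_n => y 0 k) (v 0 k).
Proof.
rewrite -(derive_coord x); apply/derivableP/diff_derivable.
exact: differentiable_coord.
Qed.

(** A combination of coordinate functions, the form to which the rules of differentiation apply. *)
Let quadraticE c w : quadratic c w =
  \sum_(k < n) ((c / 2) \*: ((fun y : 'rV[R]_n => y 0 k) * (fun y => y 0 k)) -
    w 0 k \*: (fun y => y 0 k)).
Proof.
apply/funext => y; rewrite fct_sumE /quadratic /dotv mulr_sumr -sumrB.
by [].
Qed.

Lemma differentiable_quadratic c w x : differentiable (quadratic c w) x.
Proof.
rewrite quadraticE; apply: differentiable_sum => k.
have dk := @differentiable_coord R 1 n x 0 k.
by apply: differentiableB; apply: differentiableZ => //; exact: differentiableM.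
Qed.

Lemma grad_quadratic c w x : grad (quadratic c w) x = c *: x - w.
Proof.
apply/rowP => j; rewrite !mxE quadraticE.
have dk k := is_derive_coord x (delta_mx 0 j) k.
rewrite derive_val (bigD1 j)//= big1 => [|k kj].
  by rewrite !mxE !eqxx /GRing.scale /=; field.
by rewrite !mxE (negbTE kj) !scaler0 addr0 scaler0 subr0.
Qed.

(** The second-order expansion is exact, so strong convexity with constant [c] holds with
    equality. *)
Lemma quadratic_taylor c w x y :
  quadratic c w y =
  quadratic c w x + dotv (c *: x - w) (y - x) + c / 2 * norm2 (y - x) ^+ 2.
Proof.
rewrite /quadratic sqr_norm2 !(dotvBl, dotvBr, dotvZl) (dotvC y x); by field.
Qed.

End quadratic.

(** * Integrability and expectation under point masses *)

Section dirac.
Context {R : realType} {d : measure_display} {T : measurableType d}.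

Lemma integrable_dirac (a : T) (f : T -> R) :
  measurable_fun [set: T] f ->
  (\d_a : {measure set T -> \bar R}).-integrable setT (fun t => (f t)%:E).
Proof.
move=> /measurable_EFinP mf; apply/integrableP; split => //.
rewrite integral_dirac//; last exact: measurableT_comp.
by rewrite diracT mul1e ltry.
Qed.

Lemma expectation_dirac (a : T) (f : T -> R) :
  measurable_fun [set: T] f -> ('E_(\d_a : probability T R)[f] = (f a)%:E)%E.
Proof.
move=> /measurable_EFinP mf.
by rewrite unlock integral_dirac// diracT mul1e.
Qed.
End dirac.

(** * The instance whose argmin map is a translation along a line *)

Section shift.
Context {R : realType} {N m M : nat}.
Notation vecM := 'rV[R]_M.+1.
Notation vecm := 'rV[R]_m.+1.

Lemma setT_neq0 : [set: vecM] !=set0. Proof. by exists 0. Qed.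

Notation T := (borel_subset setT_neq0).

Definition point (v : vecM) : T := SigSub (mem_set (I : [set: vecM] v)).

Definition line_point (a : R) : T := point (a *: delta_mx 0 0).

(** In coordinates, mu/2 |th|^2 - L z_0 th_0: the gradient has slope [mu] in [th] and slope [L] in
    the first coordinate of [z]. *)
Definition shift_loss (mu L : R) (th : vecm) (z : T) : R :=
  quadratic mu ((L * sval z 0 0) *: delta_mx 0 0) th.

(** The slope [a i] is the effective sensitivity; the summand 1 produces the translation. *)
Definition shift_dist (a : 'I_N -> R) (i : 'I_N) (th : vecm) :
    probability T R :=
  \d_(line_point (a i * th 0 0 + 1)).

Variables (mu L : R) (a : 'I_N -> R).
Notation l := (shift_loss mu L).
Notation D := (shift_dist a).

Lemma measurable_shift_loss th : measurable_fun [set: T] (l th).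
Proof.
rewrite /shift_loss /quadratic; apply: measurable_funB => //.
under eq_fun do rewrite dotvZl.
by do 2!apply: measurable_funM => //; exact: measurable_coord.
Qed.

Lemma grad_shift_loss th z :
  grad_loss l th z = mu *: th - (L * sval z 0 0) *: delta_mx 0 0.
Proof. exact: grad_quadratic. Qed.

Lemma measurable_grad_shift_loss th k :
  measurable_fun [set: T] (fun z => grad_loss l th z 0 k).
Proof.
under eq_fun do rewrite grad_shift_loss !mxE.
apply: measurable_funB => //.
by do 2!apply: measurable_funM => //; exact: measurable_coord.
Qed.

Lemma client_risk_shift i th tth :
  client_risk l D i th tth =
  quadratic mu ((L * (a i * tth 0 0 + 1)) *: delta_mx 0 0) th.
Proof.
rewrite /client_risk expectation_dirac; last exact: measurable_shift_loss.
by rewrite /= /shift_loss /= !mxE !eqxx mulr1.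
Qed.

Lemma regular_shift : regular_instance l D.
Proof.
split.
- by move=> z th; exact: differentiable_quadratic.
- by move=> i th tth; apply: integrable_dirac; exact: measurable_shift_loss.
- move=> i th tth k; apply: integrable_dirac.
  exact: measurable_grad_shift_loss.
- move=> i th tth; under eq_fun do rewrite client_risk_shift.
  exact: differentiable_quadratic.
- move=> i th tth; under eq_fun do rewrite client_risk_shift.
  rewrite grad_quadratic; apply/rowP => k; rewrite [RHS]mxE.
  rewrite expectation_dirac; last exact: measurable_grad_shift_loss.
  by rewrite /= grad_shift_loss !mxE !eqxx mulr1.
Qed.

Lemma smooth_shift : 0 <= mu -> mu <= L -> smooth l L.
Proof.
move=> mu0 muL th th' z z'; rewrite !grad_shift_loss.
have -> : mu *: th - (L * sval z 0 0) *: delta_mx 0 0 -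
    (mu *: th' - (L * sval z' 0 0) *: delta_mx 0 0) =
    mu *: (th - th') + (L * (sval z' 0 0 - sval z 0 0)) *: delta_mx 0 0 :> vecm.
  by apply/rowP => k; rewrite !mxE; ring.
apply: le_trans (norm2_triangle _ _) _.
have L0 : 0 <= L := le_trans mu0 muL.
rewrite !norm2Z norm2_delta mulr1 normrM (ger0_norm mu0) (ger0_norm L0) mulrDr.
rewrite lerD//.
  by rewrite ler_wpM2r ?norm2_ge0.
rewrite ler_wpM2l// distrC; have := coord_le_norm2 (sval z - sval z') 0.
by rewrite !mxE.
Qed.

Lemma sensitive_shift (eps : 'I_N -> R) :
  (forall i, 0 <= a i <= eps i) -> sensitive D eps.
Proof.
move=> aeps i th th'; pose x := line_point (a i * th 0 0 + 1).
pose y := line_point (a i * th' 0 0 + 1).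
have le_eps : norm2 (sval x - sval y) <= eps i * norm2 (th - th').
  have /andP[a0 ae] := aeps i.
  rewrite /x /y /= -scalerBl norm2Z norm2_delta mulr1.
  rewrite opprD addrACA subrr addr0 -mulrBr normrM ger0_norm//.
  apply: ler_pM => //; have := coord_le_norm2 (th - th') 0.
  by rewrite !mxE.
rewrite -lee_fin in le_eps; apply: le_trans le_eps; apply: ereal_inf_lbound.
(* The point mass at the pair couples the two point masses, at the cost of their distance. *)
exists (\d_(x, y) : probability (T * T)%type R).
  move=> A mA; split; rewrite /= !diracE; congr (_%:R%:E); congr nat_of_bool.
  - by apply/idP/idP; rewrite !inE; [case|].
  - by apply/idP/idP; rewrite !inE; [case|].
rewrite integral_dirac; [|exact: measurableT|].
  by rewrite diracT mul1e.
apply/measurable_EFinP; exact: measurable_norm2_sub.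
Qed.

Variable p : 'I_N -> R.
Hypotheses (p_sum1 : \sum_(i < N) p i = 1)
  (a_sum : L * \sum_(i < N) p i * a i = mu).

(** By [a_sum] the weighted slopes add up to [mu], the curvature of the loss; this gives the
    minimizer slope exactly 1 in the deployed first coordinate. *)
Lemma risk_shift th tth :
  risk p l D th tth = quadratic mu ((mu * tth 0 0 + L) *: delta_mx 0 0) th.
Proof.
rewrite /risk; under eq_bigr do rewrite client_risk_shift.
have -> : mu * tth 0 0 + L = \sum_(i < N) p i * (L * (a i * tth 0 0 + 1)).
  have -> : mu * tth 0 0 + L = mu * tth 0 0 + L * \sum_(i < N) p i.
    by rewrite p_sum1 mulr1.
  rewrite -a_sum !mulr_sumr mulr_suml -big_split.
  by apply: eq_bigr => i _ /=; ring.
have quad_sum : mu / 2 * dotv th th = \sum_(i < N) p i * (mu / 2 * dotv th th).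
  by rewrite -mulr_suml p_sum1 mul1r.
rewrite /quadratic dotvZl mulr_suml [in RHS]quad_sum -sumrB.
by apply: eq_bigr => i _; rewrite dotvZl; ring.
Qed.

Lemma strongly_convex_shift : strongly_convex p l D mu.
Proof.
move=> th th' tth.
rewrite (_ : risk p l D ^~ tth =
    quadratic mu ((mu * tth 0 0 + L) *: delta_mx 0 0)).
  by rewrite grad_quadratic !risk_shift -quadratic_taylor.
by apply/funext => x; rewrite risk_shift.
Qed.

Lemma argmin_shift : 0 < mu ->
  is_argmin_map p l D (fun th => (th 0 0 + L / mu) *: delta_mx 0 0).
Proof.
move=> mu0 th; apply: (critical_argmin p mu) => //.
  exact: strongly_convex_shift.
rewrite (_ : risk p l D ^~ th =
    quadratic mu ((mu * th 0 0 + L) *: delta_mx 0 0)).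
  rewrite grad_quadratic scalerA -scalerBl.
  by rewrite (_ : _ - _ = 0) ?scale0r//; field; rewrite gt_eqF.
by apply/funext => x; rewrite risk_shift.
Qed.

End shift.

(** * Divergence of translation iterates, and assembly of both claims *)

Lemma shift_not_cvg {R : realType} {m : nat} (c : R) (th : nat -> 'rV[R]_m.+1) :
  c != 0 -> (forall t, th t.+1 = (th t 0 0 + c) *: delta_mx 0 0) -> ~ cvgn th.
Proof.
move=> c0 thS /cvg_ex[/= v thv].
have x_cvg : th t 0 0 @[t --> \oo] --> v 0 0.
  exact: (continuous_cvg _ (@coord_continuous _ _ _ 0 0 v) thv).
have xS_cvg : th t.+1 0 0 @[t --> \oo] --> v 0 0.
  by have := x_cvg; rewrite -(cvg_shiftS (fun t => th t 0 0)).
(* Along a convergent sequence these differences tend to 0, yet each equals [c]. *)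
have : (th t.+1 0 0 - th t 0 0) @[t --> \oo] --> v 0 0 - v 0 0.
  exact: cvgB.
rewrite subrr; under eq_fun do rewrite thS !mxE !eqxx mulr1 addrAC subrr add0r.
move/(cvg_unique (@Rhausdorff R) (cvg_cst c)) => /eqP; exact/negP.
Qed.

Theorem proposition2p8 (R : realType) (N m M : nat)
    (N_gt0 : (0 < N)%N) (m_gt0 : (0 < m)%N) (M_gt0 : (0 < M)%N)
    (p eps : 'I_N -> R) (mu L : R)
    (p_gt0 : forall i, 0 < p i) (p_sum1 : \sum_(i < N) p i = 1)
    (eps_gt0 : forall i, 0 < eps i) (mu_gt0 : 0 < mu) (L_gt0 : 0 < L) :
  (forall (Z : set 'rV[R]_M) (Z0 : Z !=set0)
      (l : 'rV[R]_m -> borel_subset Z0 -> R)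
      (D : 'I_N -> 'rV[R]_m -> probability (borel_subset Z0) R),
    regular_instance l D -> strongly_convex p l D mu -> smooth l L ->
    sensitive D eps ->
    \sum_(i < N) p i * eps i < mu / L ->
    exists Phi : 'rV[R]_m -> 'rV[R]_m,
      [/\ is_argmin_map p l D Phi, contraction2 Phi &
          exists! thPS, thPS = Phi thPS]) /\
  (mu <= L -> mu / L <= \sum_(i < N) p i * eps i ->
    exists (Z : set 'rV[R]_M) (Z0 : Z !=set0)
      (l : 'rV[R]_m -> borel_subset Z0 -> R)
      (D : 'I_N -> 'rV[R]_m -> probability (borel_subset Z0) R),
      [/\ regular_instance l D, strongly_convex p l D mu, smooth l L,
          sensitive D eps &
          exists2 Phi : 'rV[R]_m -> 'rV[R]_m, is_argmin_map p l D Phi &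
            forall th : nat -> 'rV[R]_m,
              (forall t, th t.+1 = Phi (th t)) -> ~ cvgn th]).
Proof.
split=> [Z Z0 l D reg sc sm sens epsL|muL Leps].
  (* [Phi] selects a critical point for each deployed parameter. *)
  have [Phi PhiP] := choice
    (critical_point p mu L l D p_gt0 p_sum1 mu_gt0 L_gt0 reg sm sc).
  have PhiC : contraction2 Phi.
    exists (L * (\sum_(i < N) p i * eps i) / mu); split.
    - rewrite divr_ge0 ?(ltW mu_gt0)// mulr_ge0 ?(ltW L_gt0)//.
      by apply: sumr_ge0 => i _; rewrite mulr_ge0// ltW.
    - by rewrite ltr_pdivrMr// mul1r mulrC -ltr_pdivlMr.
    - exact: (argmin_contraction p eps mu L l D).
  exists Phi; split => //; last exact: norm2_fixed_point_unique.
  by move=> t; exact: (critical_argmin p mu l D).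
(* Positive dimensions provide the first coordinates used by the instance. *)
case: m m_gt0 M M_gt0 => [//|m'] _ [//|M'] _.
pose S := \sum_(i < N) p i * eps i.
have S_gt0 : 0 < S by apply: lt_le_trans Leps; rewrite divr_gt0.
(* [Leps] amounts to [c <= 1], so the slopes [a i] stay below [eps i], while [L] times their
   weighted sum is [mu]. *)
pose c := mu / L / S.
have c_ge0 : 0 <= c by rewrite !divr_ge0// ltW.
have c_le1 : c <= 1 by rewrite ler_pdivrMr// mul1r.
pose a i := c * eps i.
have a_sum : L * \sum_(i < N) p i * a i = mu.
  have -> : \sum_(i < N) p i * a i = c * S.
    by rewrite /S mulr_sumr; apply: eq_bigr => i _; rewrite mulrCA.
  by rewrite divfK ?gt_eqF// mulrC divfK ?gt_eqF.
exists setT, setT_neq0, (shift_loss mu L), (shift_dist a); split.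
- exact: regular_shift.
- exact: strongly_convex_shift.
- by apply: smooth_shift => //; exact: ltW.
- apply: sensitive_shift => i; have e0 := ltW (eps_gt0 i).
  by rewrite mulr_ge0//= ler_piMl.
- exists (fun th => (th 0 0 + L / mu) *: delta_mx 0 0).
    exact: argmin_shift.
  by move=> th; apply: shift_not_cvg; rewrite gt_eqF// divr_gt0.
Qed.
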